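(* Let $d \geq 2$ and $N \geq 1$ be integers, and let $\boldsymbol{x}_0,\ldots,\boldsymbol{x}_{N-1} \in \mathbb{S}^d$ be an arbitrary $N$-point configuration on the unit sphere $\mathbb{S}^d \subset \mathbb{R}^{d+1}$. Let $v:[-1,1]\to\mathbb{R}$ be a function with $v(t)>0$ for all $t \in [-1,1]$ which has an antiderivative $V$ on $[-1,1]$, and let $$K_{\mathscr{C},v}(\boldsymbol{x},\boldsymbol{y}) = \int_{-1}^1 v(t) \int_{\mathbb{S}^d} 1_{C(\boldsymbol{z};t)}(\boldsymbol{x})\, 1_{C(\boldsymbol{z};t)}(\boldsymbol{y}) \, \mathrm{d}\sigma_d(\boldsymbol{z}) \, \mathrm{d}t, \qquad \boldsymbol{x},\boldsymbol{y}\in\mathbb{S}^d.$$ Then $$\frac{1}{N^2} \sum_{k,\ell=0}^{N-1} K_{\mathscr{C},v}(\boldsymbol{x}_k,\boldsymbol{x}_\ell) - \int_{-1}^1 v(t) \int_{\mathbb{S}^d} \left| \sigma_d(C(\boldsymbol{x};t)) - \frac{1}{N} \sum_{k=0}^{N-1} 1_{C(\boldsymbol{x};t)}(\boldsymbol{x}_k) \right|^2 \mathrm{d}\sigma_d(\boldsymbol{x}) \, \mathrm{d}t = \int_{\mathbb{S}^d} \int_{\mathbb{S}^d} K_{\mathscr{C},v}(\boldsymbol{x},\boldsymbol{y}) \, \mathrm{d}\sigma_d(\boldsymbol{x}) \, \mathrm{d}\sigma_d(\boldsymbol{y}).$$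
   Context: $\mathbb{S}^d = \{\boldsymbol{z}\in\mathbb{R}^{d+1} : \|\boldsymbol{z}\| = 1\}$ is the unit sphere for the Euclidean norm $\|\cdot\|$, and $\langle\cdot,\cdot\rangle$ is the standard inner product of $\mathbb{R}^{d+1}$. $\sigma_d$ is the normalized Lebesgue surface area measure on $\mathbb{S}^d$, so $\int_{\mathbb{S}^d}\mathrm{d}\sigma_d = 1$. For $\boldsymbol{x}\in\mathbb{S}^d$ and $t\in[-1,1]$, the spherical cap with center $\boldsymbol{x}$ and height $t$ is $C(\boldsymbol{x};t) = \{\boldsymbol{z}\in\mathbb{S}^d : \langle \boldsymbol{x},\boldsymbol{z}\rangle \geq t\}$. For a set $J$, $1_J$ denotes its indicator function ($1_J(\boldsymbol{x})=1$ if $\boldsymbol{x}\in J$ and $0$ otherwise). An antiderivative $V$ of $v$ on $[-1,1]$ is a function with $V' = v$ (one-sided derivatives at the endpoints); integrals over $[-1,1]$ are Lebesgue integrals. *)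

(* Defs.v *)
From HB Require Import structures.
From mathcomp Require Import all_boot all_order all_algebra.
From mathcomp Require Import all_classical all_reals all_analysis.
From mathcomp Require Import measurable_realfun.
From mathcomp Require Import lra.

(* A point of R^n is an n.-tuple R: this type carries the product sigma-algebra
   of the Borel sets of R, that is, the Borel sigma-algebra of R^n. *)

Set Implicit Arguments.
Unset Strict Implicit.
Unset Printing Implicit Defensive.

Import Order.TTheory GRing.Theory Num.Theory.
Import numFieldNormedType.Exports.

Local Open Scope classical_set_scope.
Local Open Scope ring_scope.

Section euclidean.
Context {R : realType}.

Definition dotp n (x y : n.-tuple R) : R :=
  \sum_(i < n) tnth x i * tnth y i.

Definition enorm n (x : n.-tuple R) : R := Num.sqrt (dotp x x).

Definition unit_ball n : set (n.-tuple R) := [set x | enorm x <= 1].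

Definition sphere d : set (d.+1.-tuple R) := [set x | enorm x = 1].

(* As 0^-1 = 0, the origin is mapped to itself. *)
Definition radial_proj n (x : n.-tuple R) : n.-tuple R :=
  [tuple (enorm x)^-1 * tnth x i | i < n].

Arguments unit_ball n : clear implicits.
Arguments sphere d : clear implicits.

Definition cap d (x : d.+1.-tuple R) (t : R) : set (d.+1.-tuple R) :=
  [set z | sphere d z /\ t <= dotp x z].

Lemma measurable_dotp n : measurable_fun setT (fun x : n.-tuple R => dotp x x).
Proof.
rewrite /dotp; elim: (index_enum _) => [|i s IH].
  by under eq_fun do rewrite big_nil; exact: measurable_cst.
under eq_fun do rewrite big_cons; apply: measurable_funD => //.
by apply: measurable_funM; exact: measurable_tnth.
Qed.

Lemma measurable_enorm n : measurable_fun setT (@enorm n).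
Proof.
exact: (measurableT_comp (continuous_measurable_fun (@sqrt_continuous R))
  (@measurable_dotp n)).
Qed.

Lemma measurable_unit_ball n : measurable (unit_ball n).
Proof.
rewrite -[X in measurable X]setTI.
have -> : unit_ball n = @enorm n @^-1` `]-oo, 1].
  by apply/seteqP; split => x /=; rewrite in_itv.
exact: measurable_enorm.
Qed.

Lemma measurable_sphere d : measurable (sphere d).
Proof.
rewrite -[X in measurable X]setTI.
have -> : sphere d = @enorm d.+1 @^-1` [set 1] by [].
by apply: measurable_enorm => //; exact: measurable_set1.
Qed.

Lemma measurable_radial_proj n : measurable_fun setT (@radial_proj n).
Proof.
apply/measurable_fun_tnthP => i.
rewrite (_ : _ \o _ = fun x => (enorm x)^-1 * tnth x i); last first.
  by apply/funext => x /=; rewrite tnth_mktuple.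
apply: measurable_funM; last exact: measurable_tnth.
under eq_fun do rewrite -(powR_inv1 (sqrtr_ge0 _)).
exact: (measurableT_comp (measurable_powR (-1)) (@measurable_enorm n)).
Qed.

End euclidean.

Arguments unit_ball {R} n.
Arguments sphere {R} d.

Section lebesgue_tuple.
Context {R : realType}.
Local Open Scope ereal_scope.

Definition tuple_of_pair n (p : R * n.-tuple R) : n.+1.-tuple R :=
  [tuple of p.1 :: p.2].

Lemma measurable_tuple_of_pair n : measurable_fun setT (@tuple_of_pair n).
Proof. exact: measurable_cons. Qed.

Section lebesgue_cons.
Context n (m : {sigma_finite_measure set (n.-tuple R) -> \bar R}).

Definition lebesgue_cons : set (n.+1.-tuple R) -> \bar R :=
  pushforward (@lebesgue_measure R \x m) (@tuple_of_pair n).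

Let mcons := @measurable_tuple_of_pair n.

Let lebesgue_cons0 : lebesgue_cons set0 = 0.
Proof. by rewrite /lebesgue_cons /pushforward preimage_set0 measure0. Qed.

Let lebesgue_cons_ge0 A : 0 <= lebesgue_cons A.
Proof. exact: measure_ge0. Qed.

Let lebesgue_cons_sigma_additive : semi_sigma_additive lebesgue_cons.
Proof. exact: measure_semi_sigma_additive. Qed.

HB.instance Definition _ := isMeasure.Build _ _ _ lebesgue_cons
  lebesgue_cons0 lebesgue_cons_ge0 lebesgue_cons_sigma_additive.

Let lebesgue_cons_sigma_finite : sigma_finite setT lebesgue_cons.
Proof.
have /sigma_finiteP[F [FT ndF Foo]] := sigma_finiteT (@lebesgue_measure R).
have /sigma_finiteP[G [GT ndG Goo]] := sigma_finiteT m.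
pose f := fun t : n.+1.-tuple R => (thead t, [tuple of behead t]).
have fK p : f (tuple_of_pair p) = p.
  by case: p => a b; rewrite /f/=; congr pair; exact: val_inj.
have mf : measurable_fun setT f.
  apply: measurable_fun_pair; first exact: measurable_tnth.
  exact: measurable_behead.
exists (fun k => f @^-1` (F k `*` G k)).
  rewrite -preimage_bigcup (_ : \bigcup_k _ = setT) ?preimage_setT//.
  rewrite -subTset => -[x y] _.
  have [i _ Fx] : (\bigcup_k F k) x by rewrite -FT.
  have [j _ Gy] : (\bigcup_k G k) y by rewrite -GT.
  exists (maxn i j) => //; split => /=.
    by move: Fx; exact/subsetPset/ndF/leq_maxl.
  by move: Gy; exact/subsetPset/ndG/leq_maxr.
move=> k; have [mF Fkoo] := Foo k; have [mG Gkoo] := Goo k; split.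
  by rewrite -[X in measurable X]setTI; apply: mf => //; exact: measurableX.
rewrite /lebesgue_cons /pushforward (_ : _ @^-1` _ = F k `*` G k); last first.
  by rewrite -comp_preimage (_ : f \o _ = id) ?preimage_id//; exact/funext.
by rewrite product_measure1E// lte_mul_pinfty// ge0_fin_numE.
Qed.

HB.instance Definition _ := Measure_isSigmaFinite.Build _ _ _ lebesgue_cons
  lebesgue_cons_sigma_finite.

End lebesgue_cons.

(* Lebesgue measure on R^n, as an iterated product measure. *)
Fixpoint lebesgue_tuple n : {sigma_finite_measure set (n.-tuple R) -> \bar R} :=
  if n is n'.+1 then lebesgue_cons (lebesgue_tuple n') else \d_[tuple].

Local Close Scope ereal_scope.

Lemma measurable_cube n (a : R) :
  measurable [set x : n.-tuple R | forall i, tnth x i \in `[- a, a]].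
Proof.
rewrite (_ : [set x | _] = \bigcap_(i in [set: 'I_n])
    ((fun x : n.-tuple R => tnth x i) @^-1` `[- a, a]%classic)); last first.
  by apply/seteqP; split => x /= h i; [move=> _|]; exact: h.
apply: fin_bigcap_measurable => // i _.
by rewrite -[X in measurable X]setTI; exact: measurable_tnth.
Qed.

Lemma lebesgue_tuple_cube n (a : R) : 0 <= a ->
  lebesgue_tuple n [set x | forall i, tnth x i \in `[- a, a]] =
  ((a *+ 2) ^+ n)%:E.
Proof.
move=> a0; elim: n => [|n IHn] /=.
  by rewrite diracE mem_set// => -[].
rewrite /lebesgue_cons /pushforward.
pose C := [set x : n.-tuple R | forall i, tnth x i \in `[- a, a]].
have mC : measurable C by exact: measurable_cube.
rewrite (_ : _ @^-1` _ = `[- a, a]%classic `*` C); last first.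
  apply/seteqP; split => [[b x] /= h|[b x] /= [hb hx] i].
    split; first by have := h ord0; rewrite (tnth_nth b).
    by move=> i; have := h (lift ord0 i); rewrite !(tnth_nth b).
  case: (unliftP ord0 i) => [j|] ->; last by rewrite (tnth_nth b).
  by have := hx j; rewrite !(tnth_nth b).
rewrite product_measure1E// IHn /= lebesgue_measure_itv/= lte_fin.
have [a_gt0|] := ltP (- a) a.
  by rewrite -EFinD -EFinM exprS opprK mulr2n.
move=> aa; have -> : a = 0 by apply/eqP; rewrite eq_le a0 andbT; lra.
by rewrite mul0e mul0rn exprS mul0r.
Qed.

End lebesgue_tuple.

Section sphere_measure.
Context {R : realType} (d : nat).

Let vol : {measure set (d.+1.-tuple R) -> \bar R} := lebesgue_tuple d.+1.
Let ball : set (d.+1.-tuple R) := unit_ball d.+1.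
Let proj := @radial_proj R d.+1.
Let mball : measurable ball := @measurable_unit_ball R d.+1.
Let mproj : measurable_fun setT proj := @measurable_radial_proj R d.+1.

Let mpreim A : measurable A -> measurable (proj @^-1` A).
Proof. by move=> mA; rewrite -[X in measurable X]setTI; exact: mproj. Qed.

(* Normalized cone measure: for A included in the sphere, the proportion of
   the volume of the unit ball occupied by the points r *: z with z in A and
   0 < r <= 1. *)
Definition sphere_measure (A : set (d.+1.-tuple R)) : \bar R :=
  (vol (proj @^-1` A `&` ball) * (fine (vol ball))^-1%:E)%E.

Let vol_ball_gt0 : (0 < vol ball)%E.
Proof.
pose a : R := d.+1%:R^-1.
have a_gt0 : 0 < a by rewrite invr_gt0 ltr0n.
have mC : measurable [set x : d.+1.-tuple R | forall i, tnth x i \in `[- a, a]].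
  exact: measurable_cube.
apply: (@lt_le_trans _ _ (((a *+ 2) ^+ d.+1)%:E)).
  by rewrite lte_fin exprn_gt0// pmulrn_rgt0.
rewrite -lebesgue_tuple_cube; last exact: ltW.
apply: (le_measure vol); rewrite ?inE// => x /= hx.
rewrite /ball /unit_ball/= /enorm -sqrtr1 ler_sqrt// /dotp.
apply: (@le_trans _ _ (\sum_(i < d.+1) a)).
  apply: ler_sum => i _; have := hx i; rewrite in_itv/= => /andP[h1 h2].
  have a1 : a <= 1 by rewrite invf_le1 ?ltr0n// ler1n.
  by nra.
by rewrite sumr_const card_ord -mulr_natr mulVf// pnatr_eq0.
Qed.

Let vol_ball_lty : (vol ball < +oo)%E.
Proof.
have mC : measurable [set x : d.+1.-tuple R | forall i, tnth x i \in `[-1, 1]].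
  exact: measurable_cube.
apply: (@le_lt_trans _ _ (((1 *+ 2) ^+ d.+1)%:E)); last exact: ltry.
rewrite -lebesgue_tuple_cube//.
apply: (le_measure vol); rewrite ?inE// => x /= hx i.
have {hx} : dotp x x <= 1 by move: hx; rewrite /ball /unit_ball/= /enorm -[leRHS]sqrtr1 ler_sqrt.
rewrite /dotp (bigD1 i)//= => hx; rewrite in_itv/=.
have : 0 <= \sum_(j < d.+1 | j != i) tnth x j * tnth x j.
  by apply: sumr_ge0 => j _; rewrite -expr2 sqr_ge0.
by move=> h; apply/andP; split; nra.
Qed.

Let sphere_measure0 : sphere_measure set0 = 0%E.
Proof. by rewrite /sphere_measure preimage_set0 set0I measure0 mul0e. Qed.

Let sphere_measure_ge0 A : (0 <= sphere_measure A)%E.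
Proof.
by rewrite mule_ge0// lee_fin invr_ge0 fine_ge0// measure_ge0.
Qed.

Let sphere_measure_sigma_additive : semi_sigma_additive sphere_measure.
Proof.
move=> F mF tF mUF; rewrite /sphere_measure.
under eq_fun do rewrite -ge0_sume_distrl//.
apply: cvgeZr => //.
rewrite preimage_bigcup setI_bigcupl.
apply: measure_semi_sigma_additive.
- by move=> n; apply: measurableI => //; exact: mpreim.
- apply: trivIset_setIr; apply/trivIsetP => /= i j _ _ ij.
  rewrite -preimage_setI.
  by move/trivIsetP : tF => /(_ _ _ _ _ ij) ->//; rewrite preimage_set0.
- rewrite -setI_bigcupl -preimage_bigcup.
  by apply: measurableI => //; exact: mpreim.
Qed.

HB.instance Definition _ := isMeasure.Build _ _ _ sphere_measure
  sphere_measure0 sphere_measure_ge0 sphere_measure_sigma_additive.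

Let sphere_measureT : sphere_measure setT = 1%E.
Proof.
rewrite /sphere_measure preimage_setT setTI.
have fin : vol ball \is a fin_num by rewrite ge0_fin_numE.
by rewrite -{1}(fineK fin) -EFinM divff// gt_eqF// fine_gt0// vol_ball_gt0.
Qed.

HB.instance Definition _ := Measure_isProbability.Build _ _ _ sphere_measure
  sphere_measureT.

Lemma sphere_measure_sphere : sphere_measure (sphere d) = 1%E.
Proof.
rewrite -sphere_measureT /sphere_measure preimage_setT setTI; congr (_ * _)%E.
pose Z := [set x : d.+1.-tuple R | forall i, tnth x i \in `[- 0, 0]].
have mZ : measurable Z by exact: measurable_cube.
have Z0 : vol Z = 0%E.
  by rewrite [LHS](@lebesgue_tuple_cube R d.+1 0)// mul0rn expr0n.
have mS := mpreim (@measurable_sphere R d).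
apply/eqP; rewrite eq_le; apply/andP; split.
  by apply: (le_measure vol); rewrite ?inE//; exact: measurableI.
have -> : vol (proj @^-1` sphere d `&` ball) =
    (vol (proj @^-1` sphere d `&` ball) + vol Z)%E by rewrite Z0 adde0.
apply: (le_trans _ (measureU2 _ _ _)) => //; last exact: measurableI.
apply: (le_measure vol); rewrite ?inE//.
  by apply: measurableU => //; exact: measurableI.
move=> x xball; have [x0|x0] := eqVneq (dotp x x) 0; [right|left; split => //].
  move=> i; rewrite oppr0 in_itv/= -eq_le eq_sym.
  move/eqP : x0; rewrite psumr_eq0; last first.
    by move=> j _; rewrite -expr2 sqr_ge0.
  by move=> /allP /(_ i (mem_index_enum _)) /=; rewrite mulf_eq0 orbb.
have xx_gt0 : 0 < dotp x x.
  by rewrite lt_def x0/=; apply: sumr_ge0 => j _; rewrite -expr2 sqr_ge0.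
rewrite /preimage /sphere/= /enorm.
have -> : dotp (proj x) (proj x) = (enorm x)^-1 ^+ 2 * dotp x x.
  rewrite /dotp big_distrr/=; apply: eq_bigr => i _.
  by rewrite !tnth_mktuple mulrACA expr2.
by rewrite exprVn sqr_sqrtr ?ltW// mulVf// sqrtr1.
Qed.

End sphere_measure.

Arguments sphere_measure {R} d A.

Section kernel.
Context {R : realType}.

(* Since s stays in [a, b], this is a one-sided derivative at a and at b. *)
Definition antiderivative_on (a b : R) (v V : R -> R) : Prop :=
  forall t, t \in `[a, b] ->
    (V s - V t) / (s - t) @[s --> within `[a, b]%classic t^'] --> v t.

Definition K_cap d (v : R -> R) (x y : d.+1.-tuple R) : R :=
  \int[lebesgue_measure]_(t in `[-1, 1])
    (v t * \int[sphere_measure d]_(z in sphere d)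
             (\1_(cap z t) x * \1_(cap z t) y)).

End kernel.

(* Main.v *)
(* Expand the square in the discrepancy. The quadratic term gives the double sum
   of kernels, so the identity reduces to the fact that sigma_d (C(z; t)) is a
   function c(t) of t alone: the linear term is then 2 c(t)^2, the constant term
   is c(t)^2, and by Tonelli the double integral of the kernel is the integral of
   v c^2 (a point y lies in C(z; t) iff z lies in C(y; t)).
   That c(t) does not depend on z is reduced, through the cone measure, to the
   invariance of Lebesgue measure under the Householder reflection exchanging two
   points of the sphere. Integrability of v follows from Fatou's lemma applied to
   the difference quotients of the increasing function V. *)
Require Import Defs.
From HB Require Import structures.
From mathcomp Require Import all_boot all_order all_algebra.
From mathcomp Require Import all_classical all_reals all_analysis.
From mathcomp Require Import measurable_realfun lra ring.
Import Order.TTheory GRing.Theory Num.Theory.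
Import numFieldNormedType.Exports.

Set Implicit Arguments.
Unset Strict Implicit.
Unset Printing Implicit Defensive.

Local Open Scope classical_set_scope.
Local Open Scope ring_scope.

(** * Translation and reflection invariance of Lebesgue measure *)

Section invariant_measure.
Local Open Scope ereal_scope.
Context d (T : measurableType d) (R : realType).
Variables (mu : {measure set T -> \bar R}) (phi : T -> T).
Hypothesis mphi : measurable_fun setT phi.
Hypothesis inv_phi : forall A, measurable A -> mu (phi @^-1` A) = mu A.

(** Change of variables: [phi] pushes [mu] forward to itself, and an integral depends only on the
    values of the measure on measurable sets. *)
Lemma ge0_integral_invariant (f : T -> \bar R) :
  measurable_fun setT f -> (forall x, 0 <= f x) ->
  \int[mu]_x f (phi x) = \int[mu]_x f x.
Proof.
move=> mf f0.
transitivity (\int[pushforward mu phi]_(y in setT) f y).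
  by rewrite ge0_integral_pushforward// preimage_setT.
by apply: eq_measure_integral => A mA _; exact: inv_phi.
Qed.

End invariant_measure.

Section translation.
Context {R : realType}.

Lemma measurable_translate (a : R) :
  measurable_fun setT (fun x : measurableTypeR R => a + x : measurableTypeR R).
Proof. exact: measurable_funD. Qed.

(** The translated measure gives each half-open interval its length, and this characterizes Lebesgue
    measure. *)
Lemma lebesgue_measure_translate (a : R) (A : set (measurableTypeR R)) :
  measurable A ->
  lebesgue_measure ((fun x => a + x) @^-1` A) = lebesgue_measure A.
Proof.
move=> mA; have mD := measurable_translate a.
transitivity (pushforward lebesgue_measure
  (fun x : measurableTypeR R => a + x : measurableTypeR R) A) => //.
apply/esym/lebesgue_measure_unique => //= _ [[b c]] _ <-.
rewrite /pushforward /=.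
have -> : (fun x => a + x) @^-1` `]b, c]%classic = `](b - a), (c - a)]%classic.
  by apply/seteqP; split => x /=; rewrite !in_itv/= ltrBlDl lerBrDl.
rewrite !lebesgue_measure_itv/= !lte_fin ltrD2r.
by case: ifP => // _; rewrite -!EFinB; congr EFin; lra.
Qed.

Definition tadd n (a x : n.-tuple R) : n.-tuple R :=
  [tuple tnth a i + tnth x i | i < n].

Lemma measurable_tadd n :
  measurable_fun setT (fun p : n.-tuple R * n.-tuple R => tadd p.1 p.2).
Proof.
apply/measurable_fun_tnthP => i.
rewrite (_ : _ \o _ = fun p => tnth p.1 i + tnth p.2 i); last first.
  by apply/funext => p /=; rewrite tnth_mktuple.
by apply: measurable_funD;
  apply: (measurableT_comp (measurable_tnth i)).
Qed.

Lemma measurable_taddl n (a : n.-tuple R) : measurable_fun setT (tadd a).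
Proof.
exact: (measurableT_comp (@measurable_tadd n) (pair1_measurable a)).
Qed.

Definition tscale n (c : R) (x : n.-tuple R) : n.-tuple R :=
  [tuple c * tnth x i | i < n].

Lemma measurable_tscale n (c : R) : measurable_fun setT (@tscale n c).
Proof.
apply/measurable_fun_tnthP => i.
rewrite (_ : _ \o _ = fun p => c * tnth p i); last first.
  by apply/funext => p /=; rewrite tnth_mktuple.
by apply: measurable_funM => //; exact: measurable_tnth.
Qed.

(** Induction on the dimension: the measure of [A] integrates, over the first coordinate, the
    measures of its sections. One-dimensional invariance shifts the first coordinate and the
    induction hypothesis shifts each section. *)
Lemma lebesgue_tuple_translate n (a : n.-tuple R) A : measurable A ->
  lebesgue_tuple n (tadd a @^-1` A) = lebesgue_tuple n A.
Proof.
elim: n a A => [|n IHn] a A mA.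
  rewrite (_ : tadd a = id) ?preimage_id//.
  by apply/funext => x; rewrite [LHS]tuple0 [RHS]tuple0.
rewrite /= /lebesgue_cons /pushforward /= /product_measure1.
pose C := @tuple_of_pair R n @^-1` A.
have mC : measurable C.
  by rewrite -[X in measurable X]setTI; exact: measurable_tuple_of_pair.
rewrite -[RHS](ge0_integral_invariant (measurable_translate (thead a))); last 3 first.
- exact: lebesgue_measure_translate.
- exact: measurable_fun_xsection.
- by move=> x; exact: measure_ge0.
apply: eq_integral => s _ /=.
rewrite -[RHS](IHn [tuple of behead a]); last exact: measurable_xsection.
congr (lebesgue_tuple n _); apply/seteqP.
suff h y : tadd a (tuple_of_pair (s, y)) =
    tuple_of_pair (thead a + s, tadd [tuple of behead a] y).
  by split => y; rewrite /xsection/= !inE /= h.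
apply/eq_from_tnth => i; rewrite tnth_mktuple.
case: (unliftP ord0 i) => [j|] ->.
  rewrite !tnthS tnth_mktuple; congr (_ + _).
  by rewrite !(tnth_nth 0)/= nth_behead.
by rewrite !tnth0.
Qed.

End translation.

Section reflection.
Context {R : realType}.
Implicit Types n : nat.

Lemma taddC n (x y : n.-tuple R) : tadd x y = tadd y x.
Proof. by apply/eq_from_tnth => i; rewrite !tnth_mktuple addrC. Qed.

Lemma taddKN n (x y : n.-tuple R) : tadd (tscale (-1) (tadd x y)) x = tscale (-1) y.
Proof. by apply/eq_from_tnth => i; rewrite !tnth_mktuple; lra. Qed.

Local Open Scope ereal_scope.

(* Weil's argument for the uniqueness of Haar measure: translating by H x and
   then by H y inside the double integral of 1_A(H x) 1_B(y) gives
   vol (H^-1 A) * vol B = vol A * vol B. *)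
Lemma lebesgue_tuple_involution n (H : n.-tuple R -> n.-tuple R)
    (B : set (n.-tuple R)) :
  measurable_fun setT H -> involutive H ->
  (forall x y, H (tadd x y) = tadd (H x) (H y)) ->
  measurable B -> (forall x, B (tscale (-1) (H x)) <-> B x) ->
  lebesgue_tuple n B \is a fin_num -> lebesgue_tuple n B != 0 ->
  forall A, measurable A -> lebesgue_tuple n (H @^-1` A) = lebesgue_tuple n A.
Proof.
move=> mH HK HD mB HB Bfin B0 A mA.
pose vol : {sigma_finite_measure set (n.-tuple R) -> \bar R} := lebesgue_tuple n.
have mpre (f : n.-tuple R -> n.-tuple R) C : measurable_fun setT f ->
    measurable C -> measurable (f @^-1` C).
  by move=> mf mC; rewrite -[X in measurable X]setTI; exact: mf.
have intE C : measurable C -> vol C = \int[vol]_x (\1_C x)%:E.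
  by move=> mC; rewrite integral_indic// setIT.
have mE C : measurable C -> measurable_fun setT (fun x : n.-tuple R => (\1_C x)%:E : \bar R).
  by move=> mC; apply/measurable_EFinP; exact: measurable_indic.
have E0 (T : Type) (C : set T) x : 0 <= (\1_C x)%:E :> \bar R by rewrite lee_fin.
have trans a f : measurable_fun setT f -> (forall x, 0 <= f x) ->
    \int[vol]_x f (tadd a x) = \int[vol]_x f x.
  move=> mf f0; apply: ge0_integral_invariant => //; first exact: measurable_taddl.
  exact: lebesgue_tuple_translate.
have key : vol (H @^-1` A) * vol B = vol A * vol B.
  transitivity (\int[vol]_x \int[vol]_y
      ((\1_A (H x))%:E * (\1_B (tadd (tscale (-1) (H x)) y))%:E)).
    rewrite (intE (H @^-1` A)); last exact: mpre.
    rewrite -ge0_integralZr ?measure_ge0//; last by apply: mE; exact: mpre.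
    apply: eq_integral => x _.
    rewrite ge0_integralZl//; last first.
      by apply: (measurableT_comp (mE _ mB)); exact: measurable_taddl.
    by congr (_ * _); rewrite (trans _ (fun y => (\1_B y)%:E)) ?intE//; exact: mE.
  pose F (p : n.-tuple R * n.-tuple R) :=
    (\1_A (H p.1))%:E * (\1_B (tadd (tscale (-1) (H p.1)) p.2))%:E : \bar R.
  have mH1 : measurable_fun setT (fun p : n.-tuple R * n.-tuple R => H p.1).
    exact: measurableT_comp.
  have mF : measurable_fun setT F.
    apply: emeasurable_funM; first exact: (measurableT_comp (mE _ mA) mH1).
    apply: (measurableT_comp (mE _ mB)).
    apply: (measurableT_comp (@measurable_tadd R n)
      (g := fun p => (tscale (-1) (H p.1), p.2))).
    apply/measurable_fun_pair => /=; last exact: measurable_snd.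
    exact: (measurableT_comp (@measurable_tscale R n (-1))).
  have F0 p : 0 <= F p by rewrite mule_ge0.
  rewrite (fubini_tonelli F)//.
  transitivity (\int[vol]_y \int[vol]_x
      ((\1_A (tadd (H x) y))%:E * (\1_B (tscale (-1) (H x)))%:E)).
    apply: eq_integral => y _.
    (* Replace x by H y + x. As H is additive and involutive, H (H y + x) = y + H x, so y cancels in
       the argument of [\1_B], leaving - H x. *)
    rewrite -[LHS](trans (H y) (fun x => F (x, y))); last 2 first.
    - exact: (measurableT_comp mF (pair2_measurable y)).
    - by move=> x; exact: F0.
    apply: eq_integral => x _.
    by rewrite /F/= HD HK taddKN taddC.
  pose G (p : n.-tuple R * n.-tuple R) :=
    (\1_A (tadd (H p.2) p.1))%:E * (\1_B (tscale (-1) (H p.2)))%:E : \bar R.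
  have mH2 : measurable_fun setT (fun p : n.-tuple R * n.-tuple R => H p.2).
    exact: measurableT_comp.
  have mG : measurable_fun setT G.
    apply: emeasurable_funM.
      apply: (measurableT_comp (mE _ mA)).
      apply: (measurableT_comp (@measurable_tadd R n) (g := fun p => (H p.2, p.1))).
      by apply/measurable_fun_pair.
    by apply: (measurableT_comp (mE _ mB)); exact: (measurableT_comp (@measurable_tscale R n (-1))).
  have G0 p : 0 <= G p by rewrite mule_ge0.
  rewrite (fubini_tonelli G)//.
  rewrite muleC [in RHS](intE B)// -ge0_integralZr//; last exact: mE.
  apply: eq_integral => x _; rewrite /G/= ge0_integralZr//; last first.
    by apply: (measurableT_comp (mE _ mA)); exact: measurable_taddl.
  rewrite (trans _ (fun y => (\1_A y)%:E))//; last exact: mE.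
  rewrite -intE// muleC; congr (_ * _); rewrite !indicE; congr ((nat_of_bool _)%:R)%:E.
  by apply/idP/idP; rewrite !inE => /HB.
(* The measure of [B] is finite and nonzero, so it can be divided out of [key]. *)
move: key; rewrite -(fineK Bfin) => /(congr1 (fun u => u * ((fine (vol B))^-1)%:E)).
rewrite -!muleA -!EFinM divff ?mule1//.
by rewrite fine_eq0.
Qed.

End reflection.

(** * Householder reflections *)

Section householder.
Context {R : realType} {n : nat}.
Implicit Types (x y z u : n.-tuple R) (a c : R).

Lemma dotpC x y : dotp x y = dotp y x.
Proof. by apply: eq_bigr => i _; rewrite mulrC. Qed.

Lemma dotpDr x y z : dotp x (tadd y z) = dotp x y + dotp x z.
Proof. by rewrite -big_split; apply: eq_bigr => i _; rewrite tnth_mktuple mulrDr. Qed.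

Lemma dotpZr x c y : dotp x (tscale c y) = c * dotp x y.
Proof.
by rewrite [in RHS]/dotp big_distrr; apply: eq_bigr => i _; rewrite tnth_mktuple mulrCA.
Qed.

Lemma dotpDl x y z : dotp (tadd y z) x = dotp y x + dotp z x.
Proof. by rewrite ![dotp _ x]dotpC dotpDr. Qed.

Lemma dotpZl x c y : dotp (tscale c y) x = c * dotp y x.
Proof. by rewrite ![dotp _ x]dotpC dotpZr. Qed.

Lemma dotp_ge0 x : 0 <= dotp x x.
Proof. by apply: sumr_ge0 => i _; rewrite -expr2 sqr_ge0. Qed.

Lemma dotp_eq0 x i : dotp x x = 0 -> tnth x i = 0.
Proof.
move/eqP; rewrite psumr_eq0 => [/allP /(_ i (mem_index_enum _))|j _] /=.
  by rewrite mulf_eq0 orbb => /eqP.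
by rewrite -expr2 sqr_ge0.
Qed.

(* With 0^-1 = 0, this is the identity when u = 0. *)
Definition householder u x : n.-tuple R :=
  tadd x (tscale (- (2 * dotp u x / dotp u u)) u).

Lemma householderD u x y :
  householder u (tadd x y) = tadd (householder u x) (householder u y).
Proof. by apply/eq_from_tnth => i; rewrite !tnth_mktuple dotpDr; ring. Qed.

Lemma householderZ u c x : householder u (tscale c x) = tscale c (householder u x).
Proof. by apply/eq_from_tnth => i; rewrite !tnth_mktuple dotpZr; ring. Qed.

Lemma dotp_householder u x y :
  dotp (householder u x) (householder u y) = dotp x y.
Proof.
rewrite /householder !(dotpDl, dotpZl, dotpDr, dotpZr).
rewrite (dotpC x u).
have [->|uu0] := eqVneq (dotp u u) 0; first by rewrite invr0; ring.
by field.
Qed.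

Lemma householderK u : involutive (householder u).
Proof.
move=> x; apply/eq_from_tnth => i; rewrite !tnth_mktuple dotpDr dotpZr.
have [->|uu0] := eqVneq (dotp u u) 0; first by rewrite invr0; ring.
by field.
Qed.

(** For u = x - y, equality of the norms gives <u, u> = -2 <u, y>. The coefficient of u in the
    reflection of y is then 1, and y + u = x. *)
Lemma householder_swap x y : dotp x x = dotp y y ->
  householder (tadd x (tscale (-1) y)) y = x.
Proof.
move=> xy; set u := tadd _ _.
have uE i : tnth u i = tnth x i - tnth y i by rewrite !tnth_mktuple mulN1r.
have uuE : dotp u u = - 2 * dotp u y.
  rewrite /u !(dotpDl, dotpZl, dotpDr, dotpZr).
  by rewrite (dotpC y x) xy; ring.
clearbody u; apply/eq_from_tnth => i; rewrite !tnth_mktuple.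
(* In the degenerate case u = 0, hence x = y, and the reflection is the identity. *)
have [u0|u0] := eqVneq (dotp u u) 0.
  move: (dotp_eq0 i u0); rewrite u0 invr0 uE => /eqP; rewrite subr_eq0 => /eqP ->.
  by ring.
have uy0 : dotp u y != 0 by apply: contra u0 => /eqP uy; rewrite uuE uy mulr0.
rewrite uuE uE.
by field.
Qed.

Lemma enorm_householder u x : enorm (householder u x) = enorm x.
Proof. by rewrite /enorm dotp_householder. Qed.

Lemma measurable_dotpl u : measurable_fun setT (dotp u).
Proof.
apply: measurable_sum => i; apply: measurable_funM => //; exact: measurable_tnth.
Qed.

Lemma measurable_householder u : measurable_fun setT (householder u).
Proof.
apply/measurable_fun_tnthP => i.
rewrite (_ : _ \o _ = fun x => tnth x i - 2 * dotp u x / dotp u u * tnth u i); last first.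
  by apply/funext => x /=; rewrite !tnth_mktuple mulNr.
apply: measurable_funB; first exact: measurable_tnth.
by do 3 (apply: measurable_funM => //); exact: measurable_dotpl.
Qed.

End householder.

(** * Independence of the measure of a cap from its center *)

Section sphere_measure_cap.
Context {R : realType} (d : nat).
Implicit Types x y z : d.+1.-tuple R.

Lemma sphere_dotp x : sphere d x -> dotp x x = 1.
Proof. by move=> x1; rewrite -(sqr_sqrtr (dotp_ge0 x)) [Num.sqrt _]x1 expr1n. Qed.

Lemma measurable_cap z t : measurable (cap z t).
Proof.
have -> : cap z t = sphere d `&` dotp z @^-1` `[t, +oo[%classic.
  by apply/seteqP; split => x [h1 h2]; split => //=; move: h2; rewrite /= in_itv/= andbT.
apply: measurableI; first exact: measurable_sphere.
by rewrite -[X in measurable X]setTI; exact: measurable_dotpl.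
Qed.

(** The reflection [H] sending z to z' is a linear isometry: it preserves the unit ball and commutes
    with radial projection. The cone over the cap at z is therefore the preimage under [H] of the
    cone over the cap at z', and [H] preserves volume. *)
Lemma sphere_measure_cap z z' t : sphere d z -> sphere d z' ->
  sphere_measure d (cap z t) = sphere_measure d (cap z' t).
Proof.
move=> Sz Sz'; pose B : set (d.+1.-tuple R) := unit_ball d.+1.
(* Total mass 1 carries the information that the ball has finite nonzero volume: with [fine +oo = 0]
   and 0^-1 = 0, the product would be 0 if the volume were 0 or infinite. *)
have volB : (lebesgue_tuple d.+1 B * (fine (lebesgue_tuple d.+1 B))^-1%:E = 1)%E.
  have := @probability_setT _ _ _ (@sphere_measure R d).
  by rewrite /= /sphere_measure preimage_setT setTI.
have Bfin : lebesgue_tuple d.+1 B \is a fin_num.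
  rewrite ge0_fin_numE//; case: (lebesgue_tuple d.+1 B) volB => //=.
  - by move=> r _; rewrite ltry.
  - by rewrite invr0 mule0 => -[] /eqP; rewrite eq_sym oner_eq0.
have B0 : lebesgue_tuple d.+1 B != 0%E.
  by apply/eqP => B0; move: volB; rewrite B0 mul0e => -[] /eqP; rewrite eq_sym oner_eq0.
rewrite /sphere_measure; congr (_ * _)%E.
have mproj C : measurable C -> measurable (@radial_proj R d.+1 @^-1` C).
  by move=> mC; rewrite -[X in measurable X]setTI; exact: measurable_radial_proj.
pose u := tadd z (tscale (-1) z'); pose H := householder u.
have HzE : H z = z'.
  by rewrite -[z'](householderK u) householder_swap// !sphere_dotp.
transitivity (lebesgue_tuple d.+1
  (H @^-1` (@radial_proj R d.+1 @^-1` cap z' t `&` B))); last first.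
  apply: (lebesgue_tuple_involution (B := B)) => //.
  - exact: measurable_householder.
  - exact: householderK.
  - exact: householderD.
  - exact: measurable_unit_ball.
  - move=> x; rewrite /B /unit_ball /= -(enorm_householder u x) /enorm.
    by rewrite dotpZl dotpZr mulrA mulrNN !mul1r.
  - by apply: measurableI; [apply: mproj; exact: measurable_cap|exact: measurable_unit_ball].
congr (lebesgue_tuple d.+1 _).
have HP x : radial_proj (H x) = H (radial_proj x).
  by rewrite /H -[radial_proj x]/(tscale _ x) householderZ -(enorm_householder u).
by apply/seteqP; split => x; rewrite /cap /sphere /B /unit_ball/= HP
  -HzE /H !enorm_householder dotp_householder.
Qed.

End sphere_measure_cap.

(** * Integrability of a positive derivative *)

Section antiderivative.
Context {R : realType}.
Variables (a b : R) (v V : R -> R).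
Hypothesis ab : a < b.
Hypothesis v_gt0 : forall t, t \in `[a, b] -> 0 < v t.
Hypothesis hV : antiderivative_on a b v V.

Let quotient_near t (e : R) : t \in `[a, b] -> 0 < e ->
  exists2 r, 0 < r & forall s, s \in `[a, b] -> s != t -> `|t - s| < r ->
    `|v t - (V s - V t) / (s - t)| < e.
Proof.
move=> tab e0; have /cvgrPdist_lt /(_ _ e0) := hV tab.
case=> r /= r0 hr; exists r => // s sab st tsr.
exact: hr.
Qed.

Lemma antiderivative_continuous : {within `[a, b], continuous V}.
Proof.
apply/subspace_continuousP => t tab; apply/cvgrPdist_lt => e e0.
have [r r0 hr] := quotient_near tab ltr01.
(* Within [r] of t the difference quotients differ from v t by less than 1, so [M] bounds them and
   |V s - V t| <= |t - s| M. *)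
pose M := `|v t| + 1; have M0 : 0 < M by rewrite ltr_wpDl.
exists (Num.min r (e / M)) => /=; first by rewrite lt_min r0 divr_gt0.
move=> s /=; rewrite lt_min => /andP[tsr tse] sab.
have [->|st] := eqVneq s t; first by rewrite subrr normr0.
have /(_ sab st tsr) hq := hr s.
have st0 : s - t != 0 by rewrite subr_eq0.
rewrite distrC -(divfK st0 (V s - V t)) normrM [`|s - t|]distrC.
rewrite mulrC.
have qM : `|(V s - V t) / (s - t)| <= M.
  rewrite -[X in `|X|](subrK (v t)) addrC (le_trans (ler_normD _ _))// lerD2l.
  by rewrite distrC ltW.
apply: le_lt_trans (_ : `|t - s| * M < _); first by rewrite ler_wpM2l.
by rewrite -ltr_pdivlMr.
Qed.

Lemma antiderivative_is_derive t : t \in `]a, b[ -> is_derive t 1 V (v t).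
Proof.
move=> tab.
have tab' : t \in `[a, b] by exact: subset_itv_oo_cc.
suff H : (h^-1 *: ((V \o shift t) (h *: 1) - V t)) @[h --> 0^'] --> v t.
  by apply: DeriveDef; [apply/cvg_ex; exists (v t)|exact/cvg_lim].
apply/cvgrPdist_lt => e e0.
have [r r0 hr] := quotient_near tab' e0.
move: tab; rewrite in_itv/= => /andP[at_ tb].
(* The two extra bounds keep t + h inside [a, b], so that the limit within [a, b] becomes a
   two-sided one. *)
exists (Num.min r (Num.min (t - a) (b - t))) => /=.
  by rewrite !lt_min r0 !subr_gt0 at_.
move=> h /=; rewrite sub0r normrN !lt_min => /and3P[hr1 hr2 hr3] h0.
have := hr (h + t); rewrite addrK opprD addrA.
rewrite /shift/= [_ *: 1]mulr1 [_^-1 *: _]mulrC; apply.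
- rewrite in_itv/=; move: hr2 hr3; rewrite !ltr_norml => /andP[? _] /andP[_ ?].
  by apply/andP; split; lra.
- by rewrite -subr_eq0 addrK.
- by rewrite addrAC subrr add0r normrN.
Qed.

Lemma antiderivative_nondecreasing :
  {in `[a, b] &, {homo V : x y / x <= y}}.
Proof.
apply: ger0_derive1_le_cc => [t tab|t tab|].
- by case: (antiderivative_is_derive tab).
- rewrite derive1E; have -> := @derive_val _ _ _ _ _ _ _ (antiderivative_is_derive tab).
  by apply/ltW/v_gt0; exact: subset_itv_oo_cc.
- exact: antiderivative_continuous.
Qed.

(* V - V a extended by constants to a nondecreasing function on R. *)
Let W (s : R) : R := V (Num.max a (Num.min b s)) - V a.

Let clampP s : Num.max a (Num.min b s) \in `[a, b].
Proof. by rewrite in_itv/= le_max lexx/= ge_max ge_min lexx (ltW ab). Qed.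

Let aab : a \in `[a, b]. Proof. by rewrite in_itv/= lexx ltW. Qed.
Let bab : b \in `[a, b]. Proof. by rewrite in_itv/= lexx ltW. Qed.

Let W_nd : nondecreasing_fun W.
Proof.
move=> s t st; rewrite lerD2r; apply: antiderivative_nondecreasing => //.
by rewrite ge_max !le_max lexx/= le_min !ge_min lexx st !orbT.
Qed.

Let W_ge0 s : 0 <= W s.
Proof.
by rewrite subr_ge0; apply: antiderivative_nondecreasing => //;
  have := clampP s; rewrite in_itv/= => /andP[].
Qed.

Let W_le s : W s <= V b - V a.
Proof.
by rewrite lerD2r; apply: antiderivative_nondecreasing => //;
  have := clampP s; rewrite in_itv/= => /andP[].
Qed.

Let W_in s : s \in `[a, b] -> W s = V s - V a.
Proof. by rewrite in_itv/= /W => /andP[as_ sb]; rewrite min_r// max_r. Qed.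

Let slope n t : R := n.+1%:R * (W (n.+1%:R^-1 + t) - W t).

Let slope_ge0 n t : 0 <= slope n t.
Proof. by rewrite mulr_ge0// subr_ge0 W_nd// lerDr invr_ge0. Qed.

Let mW : measurable_fun setT W.
Proof. exact: nondecreasing_measurable. Qed.

Let mW_translate h : measurable_fun setT (fun t : R => W (h + t)).
Proof. exact: (measurableT_comp mW (measurable_translate h)). Qed.

Let mslope n : measurable_fun setT (slope n).
Proof. by apply: measurable_funM => //; exact: measurable_funB. Qed.

Let slope_cvg t : t \in `]a, b[ -> slope n t @[n --> \oo] --> v t.
Proof.
move=> tab; apply/cvgrPdist_lt => e e0.
have tab' : t \in `[a, b] by exact: subset_itv_oo_cc.
have [r r0 hr] := quotient_near tab' e0.
move: tab; rewrite in_itv/= => /andP[at_ tb].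
(* Once the step 1/(n+1) is below b - t, both points of the quotient lie in [a, b], where [W] is V -
   V a. *)
have br0 : 0 < Num.min r (b - t) by rewrite lt_min r0 subr_gt0.
near=> n.
have : n.+1%:R^-1 < Num.min r (b - t) by near: n; exact: near_infty_natSinv_lt (PosNum br0).
rewrite lt_min => /andP[nr nbt].
have n0 : 0 < n.+1%:R^-1 :> R by rewrite invr_gt0.
have sab : n.+1%:R^-1 + t \in `[a, b] 
  by move: (n.+1%:R^-1) n0 nbt => h h0 hbt; rewrite in_itv/=; apply/andP; split; lra.
rewrite /slope !W_in// opprB addrA subrK mulrC.
have := hr _ sab; rewrite addrK invrK; apply.
  by rewrite -subr_eq0 addrK gt_eqF.
by rewrite opprD addrCA subrr addr0 normrN gtr0_norm.
Unshelve. all: by end_near. Qed.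

(** On the open interval v is the pointwise limit of the measurable functions [slope n]. *)
Let mv : measurable_fun `]a, b[ v.
Proof.
apply: (measurable_fun_cvg (h := slope)) => [n|t]; last exact: slope_cvg.
exact: measurable_funS (mslope n).
Qed.

Local Open Scope ereal_scope.
Let mu : {measure set (measurableTypeR R) -> \bar R} := lebesgue_measure.

(** The shifted interval ]a + h, b + h[ exceeds ]a, b[ at most by [b, b + h[, which has length h and
    on which [W] is at most V b - V a. *)
Let int_W_translate h : (0 < h)%R ->
  \int[mu]_(t in `]a, b[) (W (h + t))%:E <=
  \int[mu]_(t in `]a, b[) (W t)%:E + ((V b - V a) * h)%:E.
Proof.
move=> h0; pose M : R := (V b - V a)%R.
(* The integrand in the variable s = h + t, with the shifted domain encoded by an indicator so that
   translation invariance on the whole line applies. *)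
pose g s := (W s * \1_(`]a, b[%classic : set R) (s - h))%:E.
have mg : measurable_fun setT g.
  apply/measurable_EFinP; apply: measurable_funM => //.
  have mI : measurable_fun setT (\1_(`]a, b[%classic : set R) : R -> R).
    exact: measurable_indic.
  have mB : measurable_fun setT (fun s : R => s - h)%R by exact: measurable_funB.
  exact: (measurableT_comp mI mB).
have g0 s : 0 <= g s by rewrite lee_fin mulr_ge0.
have -> : \int[mu]_(t in `]a, b[) (W (h + t))%:E = \int[mu]_s g s.
  rewrite -[RHS](ge0_integral_invariant (measurable_translate h) (lebesgue_measure_translate h))//.
  rewrite [LHS]integral_mkcond; apply: eq_integral => t _; rewrite /g addrAC subrr add0r indicE patchE.
  by case: ifP => _; rewrite ?mulr1 ?mulr0.
have M0 : (0 <= M)%R by exact: le_trans (W_ge0 b) (W_le b).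
pose J : set R := `[b, (b + h)%R[%classic.
have mJ : measurable_fun setT (\1_J : R -> R).
  by apply: measurable_indic; exact: measurable_itv.
have -> : \int[mu]_(t in `]a, b[) (W t)%:E + (M * h)%:E =
    \int[mu]_s ((EFin \o W) \_ `]a, b[ s + (M * \1_J s)%:E).
  rewrite ge0_integralD//; last 4 first.
  - by move=> s _; apply: erestrict_ge0 => ? _; rewrite lee_fin.
  - apply/(measurable_restrictT _ _).1 => //; exact/measurable_EFinP/measurable_funTS.
  - by move=> s _; rewrite lee_fin mulr_ge0.
  - by apply/measurable_EFinP; exact: measurable_funM.
  rewrite -integral_mkcond; congr (_ + _).
  under eq_integral do rewrite EFinM.
  rewrite ge0_integralZl//; last exact/measurable_EFinP.
  rewrite (integral_indic mu measurableT)// ?setIT; last exact: measurable_itv.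
  rewrite [X in _ * X]lebesgue_measure_itv/= lte_fin ltrDl h0.
  by rewrite -EFinB addrAC subrr add0r.
apply: ge0_le_integral => //.
- apply: emeasurable_funD.
    apply/(measurable_restrictT _ _).1 => //; exact/measurable_EFinP/measurable_funTS.
  by apply/measurable_EFinP; exact: measurable_funM.
(* Pointwise comparison: outside the shifted interval [g] is 0; inside it, s < b is covered by the
   [W] term and s >= b by the [J] term. *)
- move=> s _; rewrite /g patchE.
  have indE (A : set R) r : A r -> \1_A r = 1%R :> R by move=> Ar; rewrite indicE mem_set.
  have [/set_mem shD|shN] := boolP ((s - h)%R \in `]a, b[%classic); last first.
    rewrite indicE (negbTE shN) mulr0 adde_ge0 ?lee_fin ?mulr_ge0//.
    by case: ifP => // _; rewrite lee_fin.
  rewrite (indE _ _ shD) mulr1; move: shD; rewrite /= in_itv/= => /andP[ash shb].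
  have [sb|bs] := ltP s b.
    rewrite mem_set ?leeDl ?lee_fin ?mulr_ge0//= in_itv/= sb andbT.
    by rewrite (lt_trans ash)// ltrBlDr ltrDl.
  rewrite memNset ?add0e; last first.
    by rewrite /= in_itv/= => /andP[_]; rewrite ltNge bs.
  have /indE -> : J s by rewrite /J/= in_itv/= bs/= -ltrBlDr.
  by rewrite mulr1 lee_fin.
Qed.

(* Fatou's lemma along the difference quotients of W, whose integrals telescope
   to at most V b - V a. *)
Lemma antiderivative_integrable : mu.-integrable `[a, b] (EFin \o v).
Proof.
have mvcc : measurable_fun `[a, b] v by exact: measurable_fun_itv_cc mv.
apply/integrableP; split; first exact/measurable_EFinP.
apply: (@le_lt_trans _ _ (\int[mu]_(t in `]a, b[) (v t)%:E)).
  rewrite -integral_itv_obnd_cbnd; last first.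
    apply: measurableT_comp => //; apply/measurable_EFinP.
    by apply: measurable_funS mvcc => //; apply: subset_itvr; rewrite bnd_simp.
  rewrite -integral_itv_bndo_bndc; last first.
    apply: measurableT_comp => //; exact/measurable_EFinP.
  rewrite le_eqVlt; apply/orP; left; apply/eqP; apply: eq_integral => t /[!inE] tab /=.
  by rewrite gtr0_norm// v_gt0//; exact: subset_itv_oo_cc.
apply: (@le_lt_trans _ _ (V b - V a)%:E); last exact: ltry.
pose f n t := (slope n t)%:E.
have mf n : measurable_fun `]a, b[ (f n).
  by apply/measurable_EFinP; exact: measurable_funS (mslope n).
have -> : \int[mu]_(t in `]a, b[) (v t)%:E =
    \int[mu]_(t in `]a, b[) limn_einf (f ^~ t).
  apply: eq_integral => t /[!inE] tab; apply/esym.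
  apply: (cvg_limn_einf_sup _).1; apply/cvg_EFin; last exact: slope_cvg.
  by near=> n.
apply: le_trans (fatou mu _ mf _) _ => //; first by move=> n t _; rewrite lee_fin.
rewrite limn_einf_lim; apply: lime_le; first exact: is_cvg_einfs.
near=> n; apply: le_trans (_ : \int[mu]_(t in `]a, b[) f n t <= _).
  by apply: ereal_inf_lbound; exists n => /=.
pose h : R := (n.+1%:R^-1)%R.
have h0 : (0 < h)%R by rewrite invr_gt0.
(* Finiteness allows the integral of [W] to be cancelled from both sides of [int_W_translate],
   leaving the bound (V b - V a) h on the integrated increment. *)
have Wfin : \int[mu]_(t in `]a, b[) (W t)%:E \is a fin_num.
  rewrite ge0_fin_numE; last by apply: integral_ge0 => t _; rewrite lee_fin.
  apply: (@le_lt_trans _ _ (\int[mu]_(t in `]a, b[) (V b - V a)%:E)).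
    apply: ge0_le_integral => //.
    - by move=> t _; rewrite lee_fin.
    - by apply/measurable_EFinP; exact: measurable_funS mW.
    - by move=> t _; rewrite lee_fin.
  rewrite integral_cst// [X in _ * X]lebesgue_measure_itv/= lte_fin ab.
  by rewrite -EFinB -EFinM ltry.
have mWB : measurable_fun setT (fun t : R => W (h + t) - W t)%R.
  by apply: measurable_funB => //; exact: mW_translate.
have := int_W_translate h0.
have -> : \int[mu]_(t in `]a, b[) (W (h + t))%:E =
    \int[mu]_(t in `]a, b[) (W t)%:E + \int[mu]_(t in `]a, b[) (W (h + t) - W t)%:E.
  rewrite -ge0_integralD//.
  - by apply: eq_integral => t _; rewrite -EFinD addrCA subrr addr0.
  - by move=> t _; rewrite lee_fin.
  - by apply/measurable_EFinP; exact: measurable_funS mW.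
  - by move=> t _; rewrite lee_fin subr_ge0 W_nd// lerDr ltW.
  - by apply/measurable_EFinP; exact: measurable_funTS.
rewrite leeD2lE// => WM.
rewrite /f; under eq_integral do rewrite EFinM.
rewrite ge0_integralZl//.
(* The factor n + 1 of the difference quotient cancels the step h = 1/(n+1). *)
- apply: le_trans (_ : (n.+1%:R)%:E * ((V b - V a) * h)%:E <= _).
    by rewrite lee_pmul2l.
  by rewrite -EFinM lee_fin mulrCA divff ?mulr1.
- by apply/measurable_EFinP; exact: measurable_funTS.
- by move=> t _; rewrite lee_fin subr_ge0 W_nd// lerDr ltW.
Unshelve. all: by end_near. Qed.

End antiderivative.

(** * The cap kernel *)

Section cap_kernel.
Context {R : realType} (d : nat).
Let T : Type := d.+1.-tuple R.
Implicit Types (x y z e : d.+1.-tuple R) (t : R).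

(* Joint version of [cap]: z |-> \1_(cap z t) x agrees on the sphere with
   z |-> \1_caps (t, (z, x)), which is symmetric in z and x. *)
Definition caps : set (R * (d.+1.-tuple R * d.+1.-tuple R)) :=
  [set p | [/\ sphere d p.2.1, sphere d p.2.2 & p.1 <= dotp p.2.1 p.2.2]].

Definition icaps t z x : R := \1_caps (t, (z, x)).

Lemma indic_cap t z x : sphere d z -> \1_(cap z t) x = icaps t z x.
Proof.
move=> Sz; rewrite /icaps !indicE; congr ((nat_of_bool _)%:R).
by apply/idP/idP; rewrite !inE /cap /caps/= => -[].
Qed.

Lemma icapsC t z x : icaps t z x = icaps t x z.
Proof.
rewrite /icaps !indicE; congr ((nat_of_bool _)%:R).
by apply/idP/idP; rewrite !inE /caps/= => -[? ?]; rewrite dotpC.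
Qed.

Lemma icaps_out t z x : ~ sphere d z -> icaps t z x = 0.
Proof. by move=> Sz; rewrite /icaps indicE memNset// => -[]. Qed.

Lemma icaps_ge0 t z x : 0 <= icaps t z x. Proof. by rewrite /icaps. Qed.

Lemma icaps_le1 t z x : icaps t z x <= 1.
Proof. by rewrite /icaps indicE lern1 leq_b1. Qed.

Lemma measurable_caps : measurable caps.
Proof.
have m1 : measurable_fun setT
    (fun p : R * (d.+1.-tuple R * d.+1.-tuple R) => p.2.1).
  exact: (measurableT_comp measurable_fst measurable_snd).
have m2 : measurable_fun setT
    (fun p : R * (d.+1.-tuple R * d.+1.-tuple R) => p.2.2).
  exact: (measurableT_comp measurable_snd measurable_snd).
have mD : measurable_fun setT (fun p : R * (d.+1.-tuple R * d.+1.-tuple R) =>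
    dotp p.2.1 p.2.2 - p.1).
  apply: measurable_funB => //.
  apply: measurable_sum => i; apply: measurable_funM.
    exact: (measurableT_comp (measurable_tnth i) m1).
  exact: (measurableT_comp (measurable_tnth i) m2).
have -> : caps = (fun p => p.2.1) @^-1` sphere d `&` (fun p => p.2.2) @^-1` sphere d
    `&` (fun p => dotp p.2.1 p.2.2 - p.1) @^-1` `[0, +oo[%classic.
  apply/seteqP; split => p /=; rewrite in_itv/= andbT subr_ge0.
    by case.
  by case=> -[].
apply: measurableI; first apply: measurableI.
- by rewrite -[X in measurable X]setTI; apply: m1 => //; exact: measurable_sphere.
- by rewrite -[X in measurable X]setTI; apply: m2 => //; exact: measurable_sphere.
- by rewrite -[X in measurable X]setTI; apply: mD => //; exact: measurable_itv.
Qed.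

Lemma measurable_icaps d' (U : measurableType d') (f : U -> R)
    (g h : U -> d.+1.-tuple R) :
  measurable_fun setT f -> measurable_fun setT g -> measurable_fun setT h ->
  measurable_fun setT (fun u => icaps (f u) (g u) (h u)).
Proof.
move=> mf mg mh; apply: (measurableT_comp (f := \1_caps : _ -> R)
  (g := fun u => (f u, (g u, h u)))).
  by apply: measurable_indic; exact: measurable_caps.
by apply/measurable_fun_pair => //; exact/measurable_fun_pair.
Qed.

Local Open Scope ereal_scope.
Let m : probability _ R := @sphere_measure R d.

(** The inner integral of the kernel at height t. It runs over the whole space because [icaps]
    vanishes off the sphere, and it is kept extended-real for the uses of Tonelli's theorem. *)
Definition Ecaps t x y : \bar R := \int[m]_z (icaps t z x * icaps t z y)%:E.

Let m_cap z z' t : sphere d z -> sphere d z' -> m (cap z t) = m (cap z' t).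
Proof. exact: sphere_measure_cap. Qed.

(** A partial integral of a nonnegative jointly measurable function is measurable in the remaining
    variable. *)
Let mEcaps d' (U : measurableType d') (f : U -> R)
    (g h : U -> d.+1.-tuple R) :
  measurable_fun setT f -> measurable_fun setT g -> measurable_fun setT h ->
  measurable_fun setT (fun u => Ecaps (f u) (g u) (h u)).
Proof.
move=> mf mg mh.
pose F (p : U * d.+1.-tuple R) :=
  (icaps (f p.1) p.2 (g p.1) * icaps (f p.1) p.2 (h p.1))%:E : \bar R.
have F0 p : 0 <= F p by rewrite lee_fin mulr_ge0// icaps_ge0.
have mF : measurable_fun setT F.
  by apply/measurable_EFinP; apply: measurable_funM; apply: measurable_icaps => //;
    exact: measurableT_comp.
exact: (measurable_fun_fubini_tonelli_F F).
Qed.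

Lemma Ecaps_ge0 t x y : 0 <= Ecaps t x y.
Proof. by apply: integral_ge0 => z _; rewrite lee_fin mulr_ge0// icaps_ge0. Qed.

Lemma Ecaps_out t x y : ~ sphere d x -> Ecaps t x y = 0.
Proof.
move=> Sx; rewrite /Ecaps (eq_integral (cst 0)) ?integral0// => z _.
by rewrite icapsC icaps_out// mul0r.
Qed.

Lemma integral_icaps t z : sphere d z ->
  \int[m]_x (icaps t z x)%:E = m (cap z t).
Proof.
move=> Sz; under eq_integral do rewrite -indic_cap//.
by rewrite (integral_indic _ measurableT) ?setIT//; exact: measurable_cap.
Qed.

(** An indicator is its own square. The cap measure c(t) is later written as [Ecaps t e e], so that
    it inherits measurability in t and the bounds 0 and 1 from [Ecaps]. *)
Lemma Ecaps_diag t e : sphere d e -> Ecaps t e e = m (cap e t).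
Proof.
move=> Se; rewrite -integral_icaps//; apply: eq_integral => z _.
by rewrite icapsC /icaps indicE; case: (_ \in _); rewrite ?mulr1 ?mulr0.
Qed.

(** By Tonelli, integrate in x first: for z on the sphere this gives the measure of the cap at z, a
    constant that factors out. By symmetry of [icaps], the remaining integral in z is the measure of
    the cap at y. *)
Lemma integral_Ecaps t e y : sphere d e -> sphere d y ->
  \int[m]_x Ecaps t x y = m (cap e t) * m (cap e t).
Proof.
move=> Se Sy.
pose F (p : d.+1.-tuple R * d.+1.-tuple R) :=
  (icaps t p.2 p.1 * icaps t p.2 y)%:E : \bar R.
have F0 p : 0 <= F p by rewrite lee_fin mulr_ge0// icaps_ge0.
have mF : measurable_fun setT F.
  by apply/measurable_EFinP; apply: measurable_funM; apply: measurable_icaps.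
rewrite [LHS](fubini_tonelli F)//.
have micaps x : measurable_fun setT (fun z => (icaps t z x)%:E : \bar R).
  by apply/measurable_EFinP; exact: measurable_icaps.
transitivity (\int[m]_z (m (cap e t) * (icaps t z y)%:E)).
  apply: eq_integral => z _; rewrite /F/=; under eq_integral do rewrite EFinM muleC.
  rewrite ge0_integralZl//; last 3 first.
  - by apply/measurable_EFinP; exact: measurable_icaps.
  - by move=> x _; rewrite lee_fin icaps_ge0.
  - by rewrite lee_fin icaps_ge0.
  rewrite muleC; have [Sz|Sz] := pselect (sphere d z); last first.
    by rewrite icaps_out// !mule0.
  by rewrite integral_icaps// -(m_cap t Se Sz).
rewrite ge0_integralZl//; last by move=> x _; rewrite lee_fin icaps_ge0.
congr (_ * _); under eq_integral do rewrite icapsC.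
by rewrite integral_icaps// (m_cap t Se Sy).
Qed.

Lemma Ecaps_le1 t x y : Ecaps t x y <= 1.
Proof.
rewrite -(probability_setT m) -[leRHS]mul1e -integral_cst//.
apply: ge0_le_integral => //.
- by move=> z _; rewrite lee_fin mulr_ge0// icaps_ge0.
- by apply/measurable_EFinP; apply: measurable_funM; exact: measurable_icaps.
- by move=> z _; rewrite lee_fin mulr_ile1// ?icaps_ge0 ?icaps_le1.
Qed.

Lemma Ecaps_fin_num t x y : Ecaps t x y \is a fin_num.
Proof.
by rewrite ge0_fin_numE ?Ecaps_ge0// (le_lt_trans (Ecaps_le1 t x y))// ltry.
Qed.

Lemma Ecaps_Rintegral t x y :
  (\int[m]_(z in sphere d) (\1_(cap z t) x * \1_(cap z t) y))%R
  = fine (Ecaps t x y).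
Proof.
rewrite /Rintegral integral_mkcond /Ecaps; congr fine; apply: eq_integral => z _.
rewrite patchE; case: ifPn => [/set_mem Sz|/negP Sz]; first by rewrite /= !indic_cap.
by rewrite icaps_out ?mul0r// => /mem_set.
Qed.

Section weight.
Variable v : R -> R.
Let mu : {sigma_finite_measure set (measurableTypeR R) -> \bar R} := lebesgue_measure.
Let D : set R := `[(-1)%R, 1%R]%classic.
Hypothesis v_ge0 : forall t, D t -> (0 <= v t)%R.
Hypothesis v_int : mu.-integrable D (EFin \o v).

Let mD : measurable D. Proof. exact: measurable_itv. Qed.

Lemma integrable_weight (g : R -> R) : measurable_fun setT g ->
  (forall t, 0 <= g t <= 1)%R -> mu.-integrable D (fun t => (v t * g t)%:E).
Proof.
move=> mg g01; apply: le_integrable v_int => //.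
  apply/measurable_EFinP; apply: measurable_funM; last exact: measurable_funTS.
  by apply/measurable_EFinP; exact: measurable_int v_int.
move=> t Dt; have /andP[g0 g1] := g01 t.
by rewrite /= !ger0_norm ?mulr_ge0 ?v_ge0// lee_fin ler_piMr// v_ge0.
Qed.

Lemma measurable_fine_Ecaps x y : measurable_fun setT (fun t : R => fine (Ecaps t x y)).
Proof. by apply: measurableT_comp => //; exact: mEcaps. Qed.

Lemma fine_Ecaps01 t x y : (0 <= fine (Ecaps t x y) <= 1)%R.
Proof. by rewrite -!lee_fin fineK ?Ecaps_fin_num// Ecaps_ge0 Ecaps_le1. Qed.

Lemma K_capE x y : K_cap v x y = (\int[mu]_(t in D) (v t * fine (Ecaps t x y)))%R.
Proof. by apply: eq_Rintegral => t _; rewrite -Ecaps_Rintegral. Qed.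

(** Domination by the integrable v makes the integral finite, so the [fine] hidden in the
    real-valued integral loses nothing. *)
Lemma EFin_K_cap x y :
  (K_cap v x y)%:E = \int[mu]_(t in D) ((v t)%:E * Ecaps t x y).
Proof.
rewrite K_capE /Rintegral fineK; last first.
  apply: integrable_fin_num => //; apply: integrable_weight.
    exact: measurable_fine_Ecaps.
  by move=> t; exact: fine_Ecaps01.
by apply: eq_integral => t _; rewrite EFinM fineK// Ecaps_fin_num.
Qed.

(** Tonelli in (z, t) reduces this to [integral_Ecaps] at each height. The value does not depend on
    y, so the outer integral in the theorem is that of a constant. *)
Lemma integral_K_cap e y : sphere d e -> sphere d y ->
  (\int[m]_(z in sphere d) K_cap v z y)%R =
  (\int[mu]_(t in D) (v t * fine (Ecaps t e e) ^+ 2))%R.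
Proof.
move=> Se Sy; rewrite /Rintegral; congr fine.
(* Extending v by 0 outside [-1, 1] turns the double integral into one over a full product space. *)
pose w : R -> \bar R := (EFin \o v) \_ D.
have w0 t : 0 <= w t by apply: erestrict_ge0 => s Ds; rewrite lee_fin v_ge0.
have mw : measurable_fun setT w.
  by apply/(measurable_restrictT _ _).1 => //; exact: measurable_int v_int.
pose F (p : d.+1.-tuple R * R) := w p.2 * Ecaps p.2 p.1 y.
have F0 p : 0 <= F p by rewrite mule_ge0// Ecaps_ge0.
have mF : measurable_fun setT F.
  apply: emeasurable_funM; first exact: measurableT_comp.
  exact: mEcaps.
have wE (u : R -> \bar R) : (((fun t => (v t)%:E * u t) \_ D) = fun t => w t * u t).
  by apply/funext => t; rewrite /w !patchE; case: ifP; rewrite ?mul0e.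
transitivity (\int[m]_z \int[mu]_t F (z, t)).
  rewrite integral_mkcond; apply: eq_integral => z _.
  rewrite -[RHS]/(\int[mu]_t (w t * Ecaps t z y)) -(wE (fun t => Ecaps t z y)).
  rewrite -integral_mkcond patchE; case: ifPn => [_|/negP Sz].
    exact: EFin_K_cap.
  rewrite (eq_integral (cst 0)) ?integral0// => t _.
  by rewrite Ecaps_out ?mule0// => /mem_set.
transitivity (\int[mu]_t \int[m]_z F (z, t)).
  exact: (@fubini_tonelli _ _ _ _ _ m mu F).
rewrite [RHS](_ : _ = \int[mu]_(t in D) ((v t)%:E * (fine (Ecaps t e e) ^+ 2)%:E))//.
rewrite [RHS]integral_mkcond wE; apply: eq_integral => t _; rewrite /F/=.
rewrite ge0_integralZl//; last 2 first.
- exact: mEcaps.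
- by move=> z _; exact: Ecaps_ge0.
congr (_ * _); rewrite (integral_Ecaps t Se Sy) -Ecaps_diag//.
by rewrite EFinM fineK ?Ecaps_fin_num.
Qed.

End weight.

End cap_kernel.

(** * Finite sums under the integral *)

Section Rintegral_sum.
Context d (T : measurableType d) (R : realType).
Variables (mu : {measure set T -> \bar R}) (D : set T).
Hypothesis mD : measurable D.

Lemma integrable_sumr (I : Type) (s : seq I) (f : I -> T -> R) :
  (forall i, mu.-integrable D (EFin \o f i)) ->
  mu.-integrable D (EFin \o (fun x => \sum_(i <- s) f i x)).
Proof.
move=> fi; rewrite (_ : _ \o _ = fun x => (\sum_(i <- s) (f i x)%:E)%E); last first.
  by apply/funext => x /=; rewrite sumEFin.
by apply: integrable_sum => // i _; exact: fi.
Qed.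

Lemma Rintegral_sum (I : Type) (s : seq I) (f : I -> T -> R) :
  (forall i, mu.-integrable D (EFin \o f i)) ->
  \int[mu]_(x in D) (\sum_(i <- s) f i x) = \sum_(i <- s) \int[mu]_(x in D) f i x.
Proof.
move=> fi; elim: s => [|i s IHs].
  rewrite big_nil; under eq_Rintegral do rewrite big_nil.
  by rewrite Rintegral_cst// mul0r.
rewrite big_cons -IHs -RintegralD//; last exact: integrable_sumr.
by apply: eq_Rintegral => x _; rewrite big_cons.
Qed.

End Rintegral_sum.

(** * Discrepancy at a fixed height *)

Section cap_discrepancy.
Context {R : realType} (d N : nat).
Variables (x : 'I_N -> d.+1.-tuple R) (e : d.+1.-tuple R).
Hypothesis N_gt0 : (0 < N)%N.
Hypothesis Sx : forall k, sphere d (x k).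
Hypothesis Se : sphere d e.
Let m : probability _ R := @sphere_measure R d.

(** With the cap measure equal to a constant c, the square expands into c^2, a linear term and a
    double sum. The linear term integrates to - 2 c^2, since each of its N indicators has integral
    c, and the double sum yields the [Ecaps] terms. *)
Lemma cap_discrepancy t :
  \int[m]_(z in sphere d)
    `|fine (m (cap z t)) - N%:R^-1 * \sum_(k < N) \1_(cap z t) (x k)| ^+ 2 =
  (N%:R ^+ 2)^-1 * (\sum_(k < N) \sum_(l < N) fine (Ecaps t (x k) (x l))) -
  fine (Ecaps t e e) ^+ 2.
Proof.
have mS : measurable (sphere d : set (d.+1.-tuple R)) by exact: measurable_sphere.
have N0 : N%:R != 0 :> R by rewrite pnatr_eq0 -lt0n.
set c := fine (Ecaps t e e).
have cE z : sphere d z -> fine (m (cap z t)) = c.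
  by move=> Sz; rewrite /c Ecaps_diag//; congr fine; exact: sphere_measure_cap.
pose p k l z := icaps t z (x k) * icaps t z (x l).
have pint k l : m.-integrable (sphere d) (EFin \o p k l).
  apply: measurable_bounded_integrable => //.
  - by rewrite (le_lt_trans (probability_le1 m _))// ltry.
  - apply: measurable_funTS; apply: measurable_funM; exact: measurable_icaps.
  - exists 1; split => // M M1 z _; apply/ltW/(le_lt_trans _ M1).
    by rewrite /p ger0_norm ?mulr_ile1 ?mulr_ge0 ?icaps_ge0 ?icaps_le1.
have pE k l : \int[m]_(z in sphere d) p k l z = fine (Ecaps t (x k) (x l)).
  rewrite -Ecaps_Rintegral; apply: eq_Rintegral => z /set_mem Sz.
  by rewrite !indic_cap.
have ppE k : \int[m]_(z in sphere d) p k k z = c by rewrite pE Ecaps_diag// cE.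
have Zint (a : R) k l : m.-integrable (sphere d) (EFin \o (fun z => a * p k l z)).
  exact: (integrableZl mS a (pint k l)).
(* Indicators being idempotent, the linear term is written with the diagonal products [p k k], so
   that [pint] and [pE] serve both sums. *)
transitivity (\int[m]_(z in sphere d) (c ^+ 2 +
   ((\sum_(k < N) (- (2 * c / N%:R)) * p k k z) +
    (\sum_(k < N) \sum_(l < N) (N%:R ^+ 2)^-1 * p k l z)))).
  apply: eq_Rintegral => z /set_mem Sz; rewrite cE// real_normK ?num_real//.
  have -> : \sum_(k < N) \1_(cap z t) (x k) = \sum_(k < N) icaps t z (x k).
    by apply: eq_bigr => k _; rewrite indic_cap.
  have -> : \sum_(k < N) \sum_(l < N) (N%:R ^+ 2)^-1 * p k l z =
      (N%:R ^+ 2)^-1 * (\sum_(k < N) icaps t z (x k)) ^+ 2.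
    rewrite [(\sum_(k < N) _) ^+ 2]expr2 big_distrl/= mulr_sumr; apply: eq_bigr => k _.
    by rewrite big_distrr/= mulr_sumr.
  rewrite -mulr_sumr.
  have -> : \sum_(k < N) p k k z = \sum_(k < N) icaps t z (x k).
    apply: eq_bigr => k _.
    by rewrite /p /icaps indicE; case: (_ \in _); rewrite ?mulr1 ?mulr0.
  by field.
have Cint : m.-integrable (sphere d) (EFin \o (fun=> c ^+ 2)).
  by apply: finite_measure_integrable_cst.
have Lint : m.-integrable (sphere d)
    (EFin \o (fun z => \sum_(k < N) - (2 * c / N%:R) * p k k z)).
  by apply: integrable_sumr => // k; exact: Zint.
have Qint k : m.-integrable (sphere d)
    (EFin \o (fun z => \sum_(l < N) (N%:R ^+ 2)^-1 * p k l z)).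
  by apply: integrable_sumr => // l; exact: Zint.
have QQint : m.-integrable (sphere d)
    (EFin \o (fun z => \sum_(k < N) \sum_(l < N) (N%:R ^+ 2)^-1 * p k l z)).
  exact: integrable_sumr.
rewrite RintegralD//; last exact: (integrableD mS Lint QQint).
rewrite RintegralD// Rintegral_cst// !Rintegral_sum//.
have -> : fine (m (sphere d)) = 1.
  by rewrite (_ : m (sphere d) = 1%E)//; exact: sphere_measure_sphere.
have -> : \sum_(k < N) \int[m]_(z in sphere d) (- (2 * c / N%:R) * p k k z) =
    - (2 * c ^+ 2).
  under eq_bigr do rewrite RintegralZl// ppE.
  by rewrite sumr_const card_ord -mulr_natr; field.
have -> : \sum_(k < N) \int[m]_(z in sphere d) (\sum_(l < N) (N%:R ^+ 2)^-1 * p k l z) =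
    (N%:R ^+ 2)^-1 * (\sum_(k < N) \sum_(l < N) fine (Ecaps t (x k) (x l))).
  rewrite mulr_sumr; apply: eq_bigr => k _.
  rewrite Rintegral_sum// mulr_sumr; apply: eq_bigr => l _.
  by rewrite RintegralZl// pE.
by ring.
Qed.

End cap_discrepancy.

(** * Integration over the height and conclusion *)

Theorem theorem1 (R : realType) (d N : nat) (hd : (2 <= d)%N) (hN : (1 <= N)%N)
    (x : 'I_N -> d.+1.-tuple R) (hx : forall k, x k \in sphere d)
    (v V : R -> R) (hv : forall t, t \in `[-1, 1] -> 0 < v t)
    (hV : antiderivative_on (-1) 1 v V) :
  (N%:R ^+ 2)^-1 * (\sum_(k < N) \sum_(l < N) K_cap v (x k) (x l)) -
  \int[lebesgue_measure]_(t in `[-1, 1])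
    (v t * \int[sphere_measure d]_(z in sphere d)
       `|fine (sphere_measure d (cap z t)) -
         N%:R^-1 * \sum_(k < N) \1_(cap z t) (x k)| ^+ 2) =
  \int[sphere_measure d]_(y in sphere d)
    \int[sphere_measure d]_(z in sphere d) K_cap v z y.
Proof.
have Sx k : sphere d (x k) by have := hx k; rewrite inE.
(* A reference center for c(t); the first point of the configuration exists because N >= 1. *)
pose e := x (Ordinal hN); have Se : sphere d e by exact: Sx.
have D11 : (-1 < 1 :> R) by lra.
have v_int := antiderivative_integrable D11 hv hV.
have v_ge0 t : `[-1, 1]%classic t -> 0 <= v t by move=> /hv/ltW.
pose mu : {sigma_finite_measure set (measurableTypeR R) -> \bar R} := lebesgue_measure.
(* The integral of v c^2: both the right-hand side and the gap between the kernel sum and the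
   discrepancy are shown to equal it. *)
pose C := \int[mu]_(t in `[-1, 1]) (v t * fine (Ecaps t e e) ^+ 2).
pose D : set (measurableTypeR R) := `[-1, 1]%classic.
have mD : measurable D by exact: measurable_itv.
have rhs : \int[sphere_measure d]_(y in sphere d)
    \int[sphere_measure d]_(z in sphere d) K_cap v z y = C.
  transitivity (\int[sphere_measure d]_(y in (sphere d : set (d.+1.-tuple R))) C).
    apply: eq_Rintegral => y /set_mem Sy.
    exact: (integral_K_cap v_ge0 v_int Se Sy).
  rewrite Rintegral_cst; last exact: measurable_sphere.
  rewrite [X in _ * fine X](_ : _ = 1%E) ?mulr1//; exact: sphere_measure_sphere.
have Gint k l : mu.-integrable D (EFin \o (fun t => v t * fine (Ecaps t (x k) (x l)))).
  apply: (integrable_weight v_ge0 v_int); first exact: measurable_fine_Ecaps.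
  by move=> t; exact: fine_Ecaps01.
have Cint : mu.-integrable D (EFin \o (fun t => v t * fine (Ecaps t e e) ^+ 2)).
  apply: (integrable_weight v_ge0 v_int).
    by apply: measurable_funX; exact: measurable_fine_Ecaps.
  by move=> t; have /andP[? ?] := fine_Ecaps01 t e e; rewrite exprn_ge0// exprn_ile1.
have SGint k : mu.-integrable D
    (EFin \o (fun t => \sum_(l < N) v t * fine (Ecaps t (x k) (x l)))).
  exact: integrable_sumr.
have SSGint : mu.-integrable D
    (EFin \o (fun t => \sum_(k < N) \sum_(l < N) v t * fine (Ecaps t (x k) (x l)))).
  exact: integrable_sumr.
rewrite rhs; set Q := (X in _ - X).
have -> : Q = (N%:R ^+ 2)^-1 * (\sum_(k < N) \sum_(l < N) K_cap v (x k) (x l)) - C.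
  (* Insert the fixed-height formula; integrability of v then justifies splitting the integral over
     t term by term. *)
  rewrite /Q; transitivity (\int[mu]_(t in D) ((N%:R ^+ 2)^-1 *
      (\sum_(k < N) \sum_(l < N) v t * fine (Ecaps t (x k) (x l))) -
      v t * fine (Ecaps t e e) ^+ 2)).
    apply: eq_Rintegral => t _; rewrite (cap_discrepancy hN Sx Se t) mulrBr mulrCA.
    congr (_ * _ - _); rewrite mulr_sumr; apply: eq_bigr => k _.
    by rewrite mulr_sumr.
  have ZSSGint : mu.-integrable D (EFin \o (fun t => (N%:R ^+ 2)^-1 *
      (\sum_(k < N) \sum_(l < N) v t * fine (Ecaps t (x k) (x l))))).
    exact: (integrableZl mD ((N%:R ^+ 2)^-1) SSGint).
  rewrite RintegralB//.
  congr (_ - _); rewrite RintegralZl//; congr (_ * _).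
  rewrite Rintegral_sum//; apply: eq_bigr => k _.
  under [RHS]eq_bigr do rewrite K_capE.
  exact: Rintegral_sum.
by rewrite opprB addrC subrK.
Qed.
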